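(* For every integer $t\ge 9$, there is a family of trees $\{T_1,T_2,T_3\}$, each with $2t^3+2$ vertices and with pathwidth two, such that no isometric-universal graph for $\{T_1,T_2,T_3\}$ that is a tree is minimum (i.e., every isometric-universal tree for this family has strictly more vertices than a minimum isometric-universal graph for it).
   Context: Graphs are finite, simple and undirected. $\mathrm{dist}_G(u,v)$ denotes the number of edges of a shortest $u$–$v$ path in $G$ ($\infty$ if none exists). A subgraph $H$ of $G$ is an isometric subgraph if $\mathrm{dist}_H(u,v)=\mathrm{dist}_G(u,v)$ for all vertices $u,v$ of $H$. A graph $\mathcal U$ is an isometric-universal graph for a family $\mathcal F$ of graphs if every graph of $\mathcal F$ is isomorphic to an isometric subgraph of $\mathcal U$; it is minimum if it has the smallest possible number of vertices among all isometric-universal graphs for $\mathcal F$. The pathwidth of a graph $G$ is the smallest integer $p$ such that $G$ is a subgraph of some interval graph with maximum clique size $p+1$. *)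

(* Defs.v *)
From mathcomp Require Import all_boot all_order.
Set Implicit Arguments. Unset Strict Implicit. Unset Printing Implicit Defensive.

Record sgraph := SGraph {
  vtx : finType;
  adj : rel vtx;
  adj_sym : symmetric adj;
  adj_irr : irreflexive adj }.

Fixpoint walkb (G : sgraph) (k : nat) (u v : vtx G) : bool :=
  match k with
  | 0 => u == v
  | k'.+1 => [exists w : vtx G, adj u w && walkb k' w v]
  end.

(* dist G u v : number of edges of a shortest u-v path, None meaning infinity.
   A shortest walk is a path, hence has fewer than #|V| edges, so the search
   range iota 0 #|V| is exhaustive; the first hit is the minimum. *)
Definition dist (G : sgraph) (u v : vtx G) : option nat :=
  ohead [seq k <- iota 0 #|vtx G| | walkb k u v].

Definition connected (G : sgraph) : Prop :=
  forall u v : vtx G, dist u v <> None.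

Definition acyclic (G : sgraph) : Prop :=
  forall c : seq (vtx G), uniq c -> 3 <= size c -> ~~ cycle (@adj G) c.

Definition is_tree (G : sgraph) : Prop := connected G /\ acyclic G.

Definition isometric_embeds (H G : sgraph) : Prop :=
  exists f : vtx H -> vtx G,
    injective f /\
    (forall u v, adj u v -> adj (f u) (f v)) /\
    (forall u v, dist (f u) (f v) = dist u v).

Definition isom_universal3 (T1 T2 T3 U : sgraph) : Prop :=
  isometric_embeds T1 U /\ isometric_embeds T2 U /\ isometric_embeds T3 U.

Definition min_isom_universal3 (T1 T2 T3 U : sgraph) : Prop :=
  isom_universal3 T1 T2 T3 U /\
  forall U' : sgraph, isom_universal3 T1 T2 T3 U' -> #|vtx U| <= #|vtx U'|.

Definition intervals_meet (I : nat * nat) (J : nat * nat) : bool :=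
  maxn I.1 J.1 <= minn I.2 J.2.

(* G is a subgraph of an interval graph (on the same vertex set) whose maximum
   clique has size at most p+1. *)
Definition pathwidth_le (G : sgraph) (p : nat) : Prop :=
  exists I : vtx G -> nat * nat,
    (forall v, (I v).1 <= (I v).2) /\
    (forall u v, adj u v -> intervals_meet (I u) (I v)) /\
    (forall S : {set vtx G},
       (forall u v, u \in S -> v \in S -> u != v -> intervals_meet (I u) (I v)) ->
       #|S| <= p.+1).

Definition pathwidth_is (G : sgraph) (p : nat) : Prop :=
  pathwidth_le G p /\ forall q, pathwidth_le G q -> p <= q.

(* Main.v *)
Require Import Defs.
From mathcomp Require Import all_boot all_order.
From mathcomp Require Import zify.

(** With D = t^3, the tree [broom D d] consists essentially of two hubs at
    distance d, each with about D leaves; take d = 2, 3, 4. A 9-cycle with three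
    hubs at pairwise distances 2, 3, 4 contains all three isometrically and has
    3 D + O(1) vertices. Since 2 + 3 + 4 is odd, three vertices of an acyclic
    graph cannot have these pairwise distances, so a universal tree has at least
    four hubs; two of them share at most one neighbour, which gives at least
    4 D - O(1) vertices. *)

Set Implicit Arguments.
Unset Strict Implicit.
Unset Printing Implicit Defensive.


(** * Walks and distances *)

Lemma walkP (G : sgraph) k (u v : vtx G) :
  reflect (exists2 p, path (@adj G) u p & last u p = v /\ size p = k)
          (walkb k u v).
Proof.
elim: k u => [|k IHk] u /=.
  apply: (iffP eqP) => [->|[p _ [<- /size0nil ->]] //].
  by exists [::].
apply: (iffP existsP) => [[w /andP[uw /IHk[p wp [lp sp]]]]|].
  by exists (w :: p); rewrite /= ?uw ?sp.
case=> [[|w p]] /=; first by move=> _ [].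
move=> /andP[uw wp] [lp [sp]].
by exists w; rewrite uw; apply/IHk; exists p.
Qed.

Lemma walk_cat (G : sgraph) k l (u v w : vtx G) :
  walkb k u v -> walkb l v w -> walkb (k + l) u w.
Proof.
move=> /walkP[p up [lp sp]] /walkP[q vq [lq sq]]; apply/walkP.
by exists (p ++ q); rewrite ?cat_path ?up ?last_cat ?size_cat lp ?sp ?sq.
Qed.

Lemma walk_edge (G : sgraph) (u v : vtx G) : adj u v -> walkb 1 u v.
Proof. by move=> uv; apply/existsP; exists v; rewrite uv /=. Qed.

Lemma walk_sym (G : sgraph) k (u v : vtx G) : walkb k u v = walkb k v u.
Proof.
suff H : forall u v : vtx G, walkb k u v -> walkb k v u.
  by apply/idP/idP; apply: H.
elim: k => [|k IHk] {}u {}v; first by rewrite /= eq_sym.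
case/existsP=> w /andP[uw /IHk vw]; rewrite -addn1.
by apply: walk_cat vw _; apply: walk_edge; rewrite adj_sym.
Qed.

Lemma dist_sym (G : sgraph) (u v : vtx G) : dist u v = dist v u.
Proof.
by rewrite /dist; congr ohead; apply: eq_filter => k; rewrite walk_sym.
Qed.

Lemma dist_SomeP (G : sgraph) k (u v : vtx G) :
  dist u v = Some k <->
  [/\ k < #|vtx G|, walkb k u v & forall j, j < k -> ~~ walkb j u v].
Proof.
rewrite /dist; set n := #|_|.
(* The search range may start at any [m], so that induction on its length goes through. *)
have gen m : ohead [seq j <- iota m n | walkb j u v] = Some k <->
    [/\ m <= k < m + n, walkb k u v & forall j, m <= j < k -> ~~ walkb j u v].
  elim: n m => [|n IHn] m /=.
    by split=> // -[]; lia.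
  case: ifP => wm /=.
    split=> [[<-]|[mk wk no]]; first by split=> //; lia.
    have [km|mk'] := leqP k m; first by congr Some; lia.
    by have := no m; rewrite wm leqnn mk' => /(_ isT).
  rewrite IHn; split=> -[mk wk no]; split=> //; try lia.
  - move=> j /andP[mj jk]; have [jm|mj'] := leqP j m; last by apply: no; lia.
    by have -> : j = m by [lia]; rewrite wm.
  - have : k <> m by move=> km; rewrite km wm in wk.
    by lia.
  - by move=> j mj; apply: no; lia.
rewrite gen; split=> -[kn wk no]; split=> //.
Qed.

Lemma dist_walk (G : sgraph) k (u v : vtx G) : dist u v = Some k -> walkb k u v.
Proof. by case/dist_SomeP. Qed.

(** A shortened path repeats no vertex, so it has fewer than [#|vtx G|] edges and lies in the search
    range of [dist]. *)
Lemma connect_dist (G : sgraph) (u v : vtx G) :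
  connect (@adj G) u v -> dist u v <> None.
Proof.
case/connectP=> p /shortenP[q uq Uq _] {p} ->; rewrite /dist => none.
have wq : walkb (size q) u (last u q) by apply/walkP; exists q.
have : size q \in [seq k <- iota 0 #|vtx G| | walkb k u (last u q)].
  rewrite mem_filter wq mem_iota /= add0n.
  by have := max_card (mem (u :: q)); rewrite (card_uniqP Uq).
by case: filter none.
Qed.

(** Serves to bound distances from below by a potential. *)
Lemma walk_lipschitz (G : sgraph) (pos : vtx G -> nat) k (u v : vtx G) :
  (forall x y, adj x y -> pos x <= (pos y).+1) ->
  walkb k u v -> pos u <= pos v + k.
Proof.
move=> lip; elim: k u => [|k IHk] u /=; first by move/eqP->; rewrite addn0.
by case/existsP=> w /andP[/lip uw /IHk]; lia.
Qed.

(** * Odd closed walks and common neighbours in acyclic graphs *)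

Lemma not_uniq_split (T : eqType) (s : seq T) : ~~ uniq s ->
  exists x s1 s2 s3, s = s1 ++ x :: s2 ++ x :: s3.
Proof.
elim: s => //= y s IHs; rewrite negb_and negbK.
case: (boolP (y \in s)) => [/splitPr[s2 s3] _|_ /= /IHs[x [s1 [s2 [s3 ->]]]]].
  by exists y, [::], s2, s3.
by exists x, (y :: s1), s2, s3.
Qed.

(** A repeated vertex cuts a closed walk into two shorter closed walks, one of them odd; descent
    ends at a list without repetition. *)
Lemma odd_cycle_uniq (T : eqType) (e : rel T) (c : seq T) :
  irreflexive e -> cycle e c -> odd (size c) ->
  exists c', [/\ uniq c', 3 <= size c' & cycle e c'].
Proof.
move=> eirr; have [n] := ubnP (size c); elim: n c => // n IHn c ltcn cc oc.
have [Uc|] := boolP (uniq c).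
  exists c; split=> //.
  (* Length 1 would be a loop, so an odd length is at least 3. *)
  by case: c cc oc {ltcn Uc} => [|x [|y [|z c]]] //=; rewrite eirr.
case/not_uniq_split=> x [s1 [s2 [s3 Ec]]]; subst c.
move: cc; rewrite -(rot_cycle (size s1)) rot_size_cat /= -catA cat_cons.
rewrite rcons_cat cat_path /= => /and3P[xs2 s2x xs3].
move: ltcn oc; rewrite !(size_cat, oddD) /= size_cat /= => ltcn oc.
have [o2|o2] := boolP (odd (size s2).+1).
  by apply: (IHn (x :: s2)); rewrite //=; [lia | rewrite rcons_path xs2].
by apply: (IHn (x :: s3 ++ s1)); rewrite //= size_cat; lia.
Qed.

Lemma acyclic_no_odd_closed_walk (G : sgraph) (u : vtx G) k :
  acyclic G -> walkb k u u -> ~~ odd k.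
Proof.
move=> acG /walkP[p up [lp <-]]; apply/negP => op.
(* The walk ends at [u], so [p], which omits the starting point, is itself a cyclic list. *)
have : cycle (@adj G) p.
  case/lastP: p up lp op => // p x ux; rewrite last_rcons => xu _; subst x.
  by rewrite -rot1_cons rot_cycle.
case/odd_cycle_uniq=> //; first exact: adj_irr.
by move=> c [Uc sc]; apply/negP; apply: acG.
Qed.

Definition nbrs (G : sgraph) (x : vtx G) : {set vtx G} := [set y | adj x y].

(** Two common neighbours [a] and [b] would close the 4-cycle [x a y b]. *)
Lemma acyclic_common_nbrs (G : sgraph) (x y : vtx G) :
  acyclic G -> x != y -> #|nbrs x :&: nbrs y| <= 1.
Proof.
move=> acG xy; apply/card_le1_eqP => a b.
rewrite !inE => /andP[xa ya] /andP[xb yb].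
apply/eqP/negPn/negP => ab.
have ne u v : adj u v -> u != v :> vtx G.
  by move=> uv; apply/eqP => euv; rewrite euv adj_irr in uv.
have := acG [:: x; a; y; b].
rewrite /= !inE !negb_or xy [a == b]eq_sym ab !ne //; last first.
- by rewrite adj_sym.
by rewrite xa yb [adj a y]adj_sym ya [adj b x]adj_sym xb; move=> /(_ isT isT).
Qed.

(** The union grows one set at a time; each of the six pairwise intersections costs at most one
    element. *)
Lemma card_four_almost_disjoint (T : finType) (P Q R S : {set T}) :
  #|P :&: Q| <= 1 -> #|P :&: R| <= 1 -> #|P :&: S| <= 1 ->
  #|Q :&: R| <= 1 -> #|Q :&: S| <= 1 -> #|R :&: S| <= 1 ->
  #|P| + #|Q| + #|R| + #|S| <= #|T| + 6.
Proof.
have IU (X Y Z : {set T}) : #|(X :|: Y) :&: Z| <= #|X :&: Z| + #|Y :&: Z|.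
  by rewrite setIUl; apply: (leq_card_setU _ _).1.
have e1 := cardsUI P Q.
have e2 := cardsUI (P :|: Q) R.
have e3 := cardsUI (P :|: Q :|: R) S.
have i2 := IU P Q R; have i3 := IU (P :|: Q) R S; have i4 := IU P Q S.
have : #|P :|: Q :|: R :|: S| <= #|T| by apply: max_card.
by clear IU; lia.
Qed.

Lemma acyclic_four_hubs (G : sgraph) (B : {set vtx G}) k :
  acyclic G -> (forall x, x \in B -> k <= #|nbrs x|) -> 3 < #|B| ->
  4 * k <= #|vtx G| + 6.
Proof.
move=> acG Bk; rewrite cardE.
have: {subset enum B <= B} by move=> x; rewrite mem_enum.
case: (enum B) (enum_uniq B) => [|p [|q [|r [|s l]]]] //= Us sB _.
have kp x : x \in [:: p, q, r, s & l] -> k <= #|nbrs x| by move/sB/Bk.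
have := (kp p, kp q, kp r, kp s); rewrite !inE !eqxx /= !orbT.
case=> [[[/(_ isT) {}kp /(_ isT) kq] /(_ isT) kr] /(_ isT) ks].
move: Us; rewrite !inE !negb_or -!andbA.
case/and5P=> pq pr ps _ /and5P[qr qs _ rs _].
have le1 := @acyclic_common_nbrs G _ _ acG.
have := (le1 _ _ pq, le1 _ _ pr, le1 _ _ ps,
         le1 _ _ qr, le1 _ _ qs, le1 _ _ rs).
case=> [[[[[lpq lpr] lps] lqr] lqs] lrs].
apply: leq_trans (card_four_almost_disjoint lpq lpr lps lqr lqs lrs).
by rewrite !mulSn mul0n addn0 !addnA !leq_add.
Qed.

Lemma set_le3_cover (T : finType) (B : {set T}) (x0 : T) : #|B| <= 3 ->
  exists p q r, forall x, x \in B -> [|| x == p, x == q | x == r].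
Proof.
rewrite cardE => B3; pose s := enum B.
(* If [B] has fewer than three elements, the default [x0] fills the missing positions; it need not
   lie in [B]. *)
exists (nth x0 s 0), (nth x0 s 1), (nth x0 s 2) => x.
rewrite -mem_enum => xB; rewrite -(nth_index x0 xB).
have : index x (enum B) < 3 by rewrite (leq_trans _ B3) // index_mem.
by case: index => [|[|[|]]] //; rewrite eqxx ?orbT.
Qed.

Lemma dist_neq (G : sgraph) (x y : vtx G) k :
  dist x y = Some k -> 0 < k -> x != y.
Proof.
case/dist_SomeP=> _ _ no k0; apply/eqP => xy.
by have := no 0 k0; rewrite xy /= eqxx.
Qed.

(* On at most three points the three distances would be those of the three
   pairs, and 2 + 3 + 4 would be the length of a closed walk. *)
Lemma acyclic_dist234_card (G : sgraph) (B : {set vtx G}) :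
  acyclic G ->
  (forall d, 2 <= d <= 4 ->
     exists x y, [/\ x \in B, y \in B & dist x y = Some d]) ->
  3 < #|B|.
Proof.
move=> acG Bd; rewrite ltnNge; apply/negP => B3.
have [x0 _] := Bd 2 isT.
have [p [q [r cov]]] := set_le3_cover x0 B3.
have key d : 2 <= d <= 4 ->
    [\/ dist p q = Some d, dist q r = Some d | dist r p = Some d].
  move=> d24; have [x [y [/cov/or3P xB /cov/or3P yB xy]]] := Bd d d24.
  have := dist_neq xy; have -> : 0 < d by [lia]; move=> /(_ isT).
  case: xB xy => /eqP->; case: yB => /eqP->; rewrite ?eqxx // => xy _;
    by [constructor 1|constructor 2|constructor 3|
        rewrite dist_sym in xy; constructor 1|
        rewrite dist_sym in xy; constructor 2|
        rewrite dist_sym in xy; constructor 3].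
have closed a b c : dist p q = Some a -> dist q r = Some b ->
    dist r p = Some c -> ~~ odd (a + b + c).
  move=> /dist_walk pq /dist_walk qr /dist_walk rp.
  exact: acyclic_no_odd_closed_walk acG (walk_cat (walk_cat pq qr) rp).
(* If the three distances sit on three different pairs, they close a walk of length 9; otherwise one
   pair has two distances and [congruence] concludes. *)
by case: (key 2 isT) (key 3 isT) (key 4 isT) => e2 [] e3 [] e4;
  first [have := closed _ _ _ e2 e3 e4 | have := closed _ _ _ e2 e4 e3
        | have := closed _ _ _ e3 e2 e4 | have := closed _ _ _ e3 e4 e2
        | have := closed _ _ _ e4 e2 e3 | have := closed _ _ _ e4 e3 e2
        | congruence].
Qed.

(** * Isometric embeddings from retractions *)

Lemma walk_hom (H G : sgraph) (f : vtx H -> vtx G) k u v :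
  (forall x y, adj x y -> adj (f x) (f y)) ->
  walkb k u v -> walkb k (f u) (f v).
Proof.
move=> fhom; elim: k u => [|k IHk] u /=; first by move/eqP->.
case/existsP=> w /andP[/fhom uw /IHk wv].
by apply/existsP; exists (f w); rewrite uw.
Qed.

Lemma walk_weak_hom (G H : sgraph) (r : vtx G -> vtx H) k u v :
  (forall x y, adj x y -> r x = r y \/ adj (r x) (r y)) -> walkb k u v ->
  exists2 j, j <= k & walkb j (r u) (r v).
Proof.
move=> rhom; elim: k u => [|k IHk] u /=.
  by move/eqP->; exists 0; rewrite //= eqxx.
case/existsP=> w /andP[/rhom uw /IHk[j jk wv]].
case: uw => [->|uw]; first by exists j => //; lia.
by exists j.+1 => //=; apply/existsP; exists (r w); rewrite uw.
Qed.

(** Neither [f] nor [r] lengthens a walk, and [r] undoes [f], so [f] preserves distances exactly.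
    Since [r] may contract edges, its walks may become shorter. *)
Lemma retract_isometric (H G : sgraph) (f : vtx H -> vtx G)
    (r : vtx G -> vtx H) :
  connected H -> (forall x y, adj x y -> adj (f x) (f y)) ->
  (forall x y, adj x y -> r x = r y \/ adj (r x) (r y)) ->
  cancel f r -> isometric_embeds H G.
Proof.
move=> conH fhom rhom fK; exists f; split; [exact: can_inj fK|split=> // u v].
case E: (dist u v) (@conH u v) => [k|] // _.
have /dist_SomeP[kH wk no] := E; apply/dist_SomeP; split.
- exact: leq_trans kH (leq_card f (can_inj fK)).
- exact: walk_hom wk.
- move=> j jk; apply/negP => /(walk_weak_hom rhom)[i ij]; rewrite !fK.
  by apply/negP/no/(leq_ltn_trans ij).
Qed.

(** * Graphs on integer labels, and trees given by parents *)

Lemma label_graph_sym n (e : rel nat) :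
  symmetric (fun u v : 'I_n => (u != v) && (e u v || e v u)).
Proof. by move=> u v; rewrite eq_sym orbC. Qed.

Lemma label_graph_irr n (e : rel nat) :
  irreflexive (fun u v : 'I_n => (u != v) && (e u v || e v u)).
Proof. by move=> u; rewrite eqxx. Qed.

(** With [e] a relation on [nat], possibly one-sided, adjacency becomes arithmetic that [lia] can
    decide. *)
Definition label_graph n (e : rel nat) : sgraph :=
  SGraph (@label_graph_sym n e) (@label_graph_irr n e).

Definition parent_rel (par : nat -> nat) : rel nat :=
  fun u v => (0 < v) && (u == par v).

Definition parent_graph n par := label_graph n (parent_rel par).

(** Following parents leads every vertex to 0. On a cycle, both neighbours of the largest label are
    smaller, hence both equal its parent, a repetition. *)
Lemma parent_graph_tree n (par : nat -> nat) :
  (forall v, 0 < v -> par v < v) -> is_tree (parent_graph n par).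
Proof.
move=> par_lt; split=> [u v|c Uc c3].
  apply: connect_dist.
  have n0 : 0 < n by apply: leq_ltn_trans (ltn_ord u).
  have root (w : 'I_n) :
      connect (@adj (parent_graph n par)) w (Ordinal n0).
    have [m] := ubnP (val w); elim: m w => // m IHm w wm.
    have [w0|w0] := posnP (val w).
      by have -> : w = Ordinal n0 by exact: val_inj.
    have pw := par_lt _ w0.
    have pn : par w < n by apply: ltn_trans pw (ltn_ord w).
    apply: (@connect_trans _ _ (Ordinal pn)); last first.
      exact/IHm/(leq_trans pw).
    apply: connect1.
    rewrite /= -val_eqE /parent_rel /= [0 < w]w0 eqxx orbT andbT.
    by rewrite neq_ltn pw orbT.
  apply: connect_trans (root u) _.
  by rewrite sym_connect_sym // => x y; rewrite adj_sym.
apply/negP => cc.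
have /hasP[x0 x0c _] : has predT c by case: c c3 {Uc cc}.
have [m mc maxm] := @arg_maxnP 'I_n x0 (mem c) (@nat_of_ord n) x0c.
have [i s Es] := rot_to mc.
have : uniq (m :: s) by rewrite -Es rot_uniq.
have : 3 <= size (m :: s) by rewrite -Es size_rot.
have : cycle (@adj (parent_graph n par)) (m :: s) by rewrite -Es rot_cycle.
have below x : x \in m :: s -> adj (m : vtx (parent_graph n par)) x ->
    val x = par m.
  rewrite -Es mem_rot => /maxm /=; rewrite -val_eqE /parent_rel /=.
  by have := par_lt x; lia.
case: s {Es} below => [|y s] // below; case/lastP: s below => [|s z] // below.
rewrite /= rcons_path last_rcons => /and3P[my _ zm] _ /andP[_ /andP[+ _]].
rewrite mem_rcons inE negb_or => /andP[/negP yz _]; apply: yz.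
rewrite -val_eqE /= below ?inE ?eqxx ?orbT //.
by rewrite (below z) // ?inE ?mem_rcons ?inE ?eqxx ?orbT // adj_sym.
Qed.

(** * Interval representations and pathwidth *)

Lemma intervals_meet_point (I J : nat * nat) z :
  I.1 <= z <= I.2 -> J.1 <= z <= J.2 -> intervals_meet I J.
Proof.
rewrite /intervals_meet => /andP[Iz zI] /andP[Jz zJ].
by rewrite geq_max !leq_min !(leq_trans Iz, leq_trans Jz).
Qed.

(** [X] meets [C] but also reaches [Y] outside [C], so it crosses an end of [C]. *)
Lemma intervals_meet_exit (C X Y : nat * nat) :
  C.1 <= C.2 -> Y.1 <= Y.2 -> intervals_meet C X -> intervals_meet X Y ->
  ~~ intervals_meet C Y -> X.1 <= C.1 <= X.2 \/ X.1 <= C.2 <= X.2.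
Proof.
case: C X Y => [c1 c2] [x1 x2] [y1 y2]; rewrite /intervals_meet /=.
rewrite !geq_max !leq_min -!andbA => c12 y12.
case/and4P=> _ cx xc x12 /and4P[_ xy yx _]; rewrite c12 y12 andbT /=.
rewrite negb_and -!ltnNge => /orP[yc|cy].
  by left; rewrite (leq_trans xy (ltnW yc)).
by right; rewrite xc (leq_trans (ltnW cy)).
Qed.

(** If no three intervals meet pairwise, each [x_i] must contain an end of the interval of [c] in
    order to reach [y_i]. Two of the three share an end, and together with [c] they form a forbidden
    triple. *)
Lemma spider_pathwidth_ge2 (G : sgraph) (c x1 x2 x3 y1 y2 y3 : vtx G) q :
  uniq [:: c; x1; x2; x3; y1; y2; y3] ->
  all (fun e => adj e.1 e.2)
    [:: (c, x1); (c, x2); (c, x3); (x1, y1); (x2, y2); (x3, y3)] ->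
  pathwidth_le G q -> 2 <= q.
Proof.
move=> U /=; case/and5P=> a1 a2 a3 b1 /and3P[b2 b3 _] [I [wf [meet clq]]].
rewrite ltnNge; apply/negP => q1.
have tri u v w : uniq [:: u; v; w] -> intervals_meet (I u) (I v) ->
    intervals_meet (I u) (I w) -> intervals_meet (I v) (I w) -> False.
  move=> Uw uv uw vw; have := clq [set z in [:: u; v; w]].
  rewrite cardsE (card_uniqP Uw) /= => H.
  suff H3 : 3 <= q.+1 by have := leq_trans H3 (q1 : q.+1 <= 2).
  apply: H => a b; rewrite !inE.
  case/or3P=> /eqP-> /or3P[]/eqP->; rewrite ?eqxx //=;
    by rewrite /intervals_meet maxnC minnC.
have leg x y : uniq [:: c; x; y] -> adj c x -> adj x y ->
    (I x).1 <= (I c).1 <= (I x).2 \/ (I x).1 <= (I c).2 <= (I x).2.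
  move=> Uxy /meet cx /meet xy.
  have cy : ~~ intervals_meet (I c) (I y).
    by apply/negP => cy; apply: tri Uxy cx cy xy.
  exact: intervals_meet_exit (wf c) (wf y) cx xy cy.
have disj x x' z : uniq [:: c; x; x'] -> adj c x -> adj c x' ->
    (I x).1 <= z <= (I x).2 -> (I x').1 <= z <= (I x').2 -> False.
  move=> Ux /meet cx /meet cx' xz xz'.
  exact: tri Ux cx cx' (intervals_meet_point xz xz').
(* Masks select the required triples from the seven distinct vertices. *)
have sub m := mask_uniq U m; pose T := true; pose F := false.
have d12 z := disj x1 x2 z (sub [:: T; T; T]) a1 a2.
have d13 z := disj x1 x3 z (sub [:: T; T; F; T]) a1 a3.
have d23 z := disj x2 x3 z (sub [:: T; F; T; T]) a2 a3.
case: (leg x1 y1 (sub [:: T; T; F; F; T]) a1 b1) => l1;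
  case: (leg x2 y2 (sub [:: T; F; T; F; F; T]) a2 b2) => l2;
  case: (leg x3 y3 (sub [:: T; F; F; T; F; F; T]) a3 b3) => l3;
  solve [exact: d12 l1 l2 | exact: d13 l1 l3 | exact: d23 l2 l3].
Qed.

(** Pairwise meeting intervals all contain the largest of their left ends, so bounding the bag at
    each point bounds every clique. *)
Lemma intervals_pathwidth_le (G : sgraph) (lo hi : vtx G -> nat) p :
  (forall v, lo v <= hi v) ->
  (forall u v, adj u v -> intervals_meet (lo u, hi u) (lo v, hi v)) ->
  (forall x, #|[set v | lo v <= x <= hi v]| <= p.+1) -> pathwidth_le G p.
Proof.
move=> wf meet bag; exists (fun v => (lo v, hi v)); split=> //.
split=> // S clq.
have [->|[z zS]] := set_0Vmem S; first by rewrite cards0.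
have [m mS maxm] := @arg_maxnP _ z (mem S) lo zS.
apply: leq_trans (bag (lo m)); apply/subset_leq_card/subsetP => v vS.
rewrite inE [lo v <= _]maxm //=; have [->|vm] := eqVneq v m; first exact: wf.
by have := clq _ _ vS mS vm; rewrite /intervals_meet /=; lia.
Qed.

(** * The brooms: tree structure, pathwidth, hub distance and degrees *)

(** Labels 1 to 4 are the two legs at hub 0, labels 5 to [4 + d] the path to the second hub, the
    rest up to [D] leaves at 0, and those above [D] leaves at [4 + d]. *)
Definition broom_par D d v :=
  if [|| v == 2, v == 4 | 5 < v < 5 + d] then v.-1
  else if D < v then 4 + d else 0.

(* Hubs 0 and 4 + d, joined by the path 0, 5, ..., 4 + d; the legs 1 - 2 and
   3 - 4 at 0 make it contain a subdivided claw. *)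
Definition broom D d := parent_graph (2 * D + 2) (broom_par D d).

(** Puts the case analysis into one boolean formula, usable by [lia]. *)
Lemma broom_parP D d v : let inner := [|| v == 2, v == 4 | 5 < v < 5 + d] in
  [|| inner && (broom_par D d v == v.-1),
      [&& ~~ inner, D < v & broom_par D d v == 4 + d]
    | [&& ~~ inner, v <= D & broom_par D d v == 0]].
Proof.
rewrite /broom_par; case: [|| v == 2, v == 4 | _] => /=; first by rewrite eqxx.
by case: leqP; rewrite /= eqxx.
Qed.

Lemma broom_par_lt D d v :
  9 <= D -> 2 <= d <= 4 -> 0 < v -> broom_par D d v < v.
Proof. by have := broom_parP D d v; lia. Qed.

Lemma broom_tree D d : 9 <= D -> 2 <= d <= 4 -> is_tree (broom D d).
Proof.
by move=> D9 d24; apply: parent_graph_tree => v; apply: broom_par_lt.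
Qed.

(** Labels out of range default to vertex 0. *)
Definition broom_vtx D d v : vtx (broom D d) :=
  insubd (Ordinal (ltn_addl (2 * D) (isT : 0 < 2))) v.

Lemma broom_vtxE D d v : v < 2 * D + 2 -> broom_vtx D d v = v :> nat.
Proof. by move=> lt; rewrite val_insubd lt. Qed.

Lemma broom_adj D d u v : u < 2 * D + 2 -> v < 2 * D + 2 -> u < v ->
  u = broom_par D d v -> adj (broom_vtx D d u) (broom_vtx D d v).
Proof.
move=> un vn uv eu; rewrite /= -val_eqE /= !broom_vtxE // /parent_rel.
by rewrite -eu eqxx neq_ltn uv (leq_trans _ uv).
Qed.

Lemma broom_pathwidth D d : 9 <= D -> 2 <= d <= 4 -> pathwidth_is (broom D d) 2.
Proof.
move=> D9 d24; have par := broom_parP D d; split; last first.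
  move=> q; apply: (@spider_pathwidth_ge2 _ (broom_vtx D d 0)
    (broom_vtx D d 1) (broom_vtx D d 3) (broom_vtx D d 5)
    (broom_vtx D d 2) (broom_vtx D d 4) (broom_vtx D d 6)).
    rewrite -(map_inj_uniq val_inj) /= !broom_vtxE //; lia.
  rewrite /= andbT; apply/and5P; split; last (apply/andP; split);
    by apply: broom_adj;
      move: (par 1) (par 2) (par 3) (par 4) (par 5) (par 6); lia.
(* Vertex [v] gets the interval from [v] to [hi v]: each hub extends over its leaves, an inner
   vertex of a leg or of the path reaches its child, and other vertices get a point. *)
pose hi v := if v == 0 then D
  else if [|| v == 1, v == 3 | 4 < v < 4 + d] then v.+1
  else if v == 4 + d then 2 * D + 1 else v.
(* Besides 0 and [x], the bag at [x] can contain only the predecessor of [x] on a leg or the path,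
   or else the second hub. *)
pose mid x := if [|| x == 2, x == 4 | 5 < x < 5 + d] then x.-1 else 4 + d.
apply: (@intervals_pathwidth_le _ (@nat_of_ord _ : vtx (broom D d) -> nat)
  (fun v : 'I__ => hi v)) => [v|u v|x].
- by rewrite /hi; do 3?case: ifP; lia.
- have half (x y : 'I_(2 * D + 2)) : parent_rel (broom_par D d) x y ->
      intervals_meet (x : nat, hi x) (y : nat, hi y).
    case/andP=> y0 /eqP xE; apply: (@intervals_meet_point _ _ y) => /=.
      rewrite xE ltnW ?broom_par_lt //=.
      case/or3P: (par y) => [/andP[yin]|/and3P[yin Dy]|/and3P[yin yD]] /eqP->.
      + by rewrite /hi; do 3?[case: ifP => ?]; lia.
      + by have := ltn_ord y; rewrite /hi eqxx; do 3?[case: ifP => ?]; lia.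
      + by rewrite /hi eqxx.
    by rewrite leqnn /hi; do 3?[case: ifP => ?]; lia.
  case/andP=> _ /orP[|/half]; first exact: half.
  by rewrite /intervals_meet maxnC minnC.
have sub : [set v : 'I_(2 * D + 2) | v <= x <= hi v] \subset
   [set v in [:: broom_vtx D d 0; broom_vtx D d x; broom_vtx D d (mid x)]].
  apply/subsetP => v; rewrite !inE -!val_eqE /= => vx.
  (* A nonempty bag forces [x] into range, so [broom_vtx D d x] is not the default. *)
  have hin : hi v < 2 * D + 2.
    by have := ltn_ord v; rewrite /hi; do 3?[case: ifP => ?]; lia.
  have midn : mid x < 2 * D + 2 by rewrite /mid; case: ifP => ?; lia.
  rewrite !broom_vtxE //; try lia.
  by move: vx; rewrite /mid /hi; do 4?[case: ifP => ?]; lia.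
apply: leq_trans (subset_leq_card sub) _.
by rewrite cardsE; apply: leq_trans (card_size _) _.
Qed.

Lemma broom_hub_dist D d : 9 <= D -> 2 <= d <= 4 ->
  dist (broom_vtx D d (4 + d)) (broom_vtx D d 0) = Some d.
Proof.
move=> D9 d24; have par := broom_parP D d.
(* Projection onto the path between the hubs; it changes by at most one along an edge, which gives
   the lower bound. *)
pose pos (v : vtx (broom D d)) :=
  if (v : 'I_ _) <= 4 then 0 else if (v : 'I_ _) <= 4 + d then v - 4
  else if (v : 'I_ _) <= D then 0 else d.
apply/dist_SomeP; split.
- by rewrite card_ord; lia.
- have arc j : j < d -> walkb j.+1 (broom_vtx D d (5 + j)) (broom_vtx D d 0).
    elim: j => [|j IHj] jd.
      apply: walk_edge; rewrite adj_sym.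
      by apply: broom_adj; move: (par (5 + 0)); lia.
    rewrite -add1n; apply: walk_cat (IHj _); last by lia.
    apply: walk_edge; rewrite adj_sym.
    by apply: broom_adj; move: (par (5 + j.+1)); lia.
  have := arc d.-1; have -> : 5 + d.-1 = 4 + d by lia.
  by have -> : d.-1.+1 = d by [lia]; apply; lia.
- move=> j jd; apply/negP => /(@walk_lipschitz _ pos).
  suff lip x y : adj x y -> pos x <= (pos y).+1.
    by move=> /(_ lip); rewrite /pos !broom_vtxE /=; do 3?[case: ifP => ?]; lia.
  rewrite /= -val_eqE /= /parent_rel /pos.
  have := (par x, par y); case.
  by do 6?[case: ifP => ?]; lia.
Qed.

(** For every [d] up to 4, labels 9 to [D] are leaves at 0; equally many leaves at the other hub are
    taken from [D + 1] on. *)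
Lemma broom_hub_nbrs D d h : 9 <= D -> 2 <= d <= 4 -> h \in [:: 0; 4 + d] ->
  D - 8 <= #|nbrs (broom_vtx D d h)|.
Proof.
move=> D9 d24; rewrite !inE => hh; have par := broom_parP D d.
pose leaf (i : 'I_(D - 8)) :=
  broom_vtx D d (if h == 0 then 9 + i else D.+1 + i).
have leafE i : leaf i = (if h == 0 then 9 + i else D.+1 + i) :> nat.
  by have lti := ltn_ord i; rewrite broom_vtxE //; case: ifP => _; lia.
have leaf_inj : injective leaf.
  move=> i j /(congr1 val); rewrite /= !leafE => ij; apply: val_inj => /=.
  by move: ij; case: ifP => _; lia.
rewrite -[D - 8]card_ord -(card_imset _ leaf_inj).
apply/subset_leq_card/subsetP => _ /imsetP[i _ ->]; rewrite inE.
have := ltn_ord i; move: (par (9 + i)) (par (D.+1 + i)) => p1 p2 lti.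
by rewrite /leaf; case: ifP => h0; apply: broom_adj; lia.
Qed.

(** * The lower bound for acyclic universal graphs *)

Lemma isometric_hubs D d (U : sgraph) : 9 <= D -> 2 <= d <= 4 ->
  isometric_embeds (broom D d) U ->
  exists x y : vtx U,
    [/\ D - 8 <= #|nbrs x|, D - 8 <= #|nbrs y| & dist x y = Some d].
Proof.
move=> D9 d24 [f [finj [fhom fdist]]].
have deg h : h \in [:: 0; 4 + d] -> D - 8 <= #|nbrs (f (broom_vtx D d h))|.
  move=> hh; apply: leq_trans (broom_hub_nbrs D9 d24 hh) _.
  rewrite -(card_imset _ finj).
  apply/subset_leq_card/subsetP => _ /imsetP[y + ->].
  by rewrite !inE => /fhom.
exists (f (broom_vtx D d (4 + d))), (f (broom_vtx D d 0)); split.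
- by apply: deg; rewrite !inE eqxx orbT.
- by apply: deg; rewrite !inE eqxx.
- by rewrite fdist broom_hub_dist.
Qed.

Lemma universal_acyclic_card D (U : sgraph) : 9 <= D -> acyclic U ->
  isom_universal3 (broom D 2) (broom D 3) (broom D 4) U ->
  4 * (D - 8) <= #|vtx U| + 6.
Proof.
move=> D9 acU [U2 [U3 U4]].
pose B := [set x : vtx U | D - 8 <= #|nbrs x|].
apply: (@acyclic_four_hubs _ B) => //; first by move=> x; rewrite inE.
apply: acyclic_dist234_card => // d d24.
have Ud : isometric_embeds (broom D d) U by case: d d24 => [|[|[|[|[|]]]]].
have [x [y [Bx By xy]]] := isometric_hubs D9 d24 Ud.
by exists x, y; rewrite !inE.
Qed.

(** * The 9-cycle with three hubs *)

Ltac split_ifs := repeat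
  match goal with |- context [if ?b then _ else _] =>
    let E := fresh "E" in destruct b eqn:E; try (exfalso; lia) end.

(** Offsets 2 and 4 hang on offsets 1 and 3, so each block offers the two legs of a broom. *)
Definition block_par hub base v :=
  if (v == base + 2) || (v == base + 4) then v.-1 else hub.

Definition hub_cycle_par D v :=
  if v < 9 then v.-1
  else if v < D + 15 then block_par 0 9 v
  else if v < 2 * D + 21 then block_par 2 (D + 15) v
  else block_par 5 (2 * D + 21) v.

(** Parents alone make 0 to 8 a path; the extra pair closes it. *)
Definition hub_cycle_rel D : rel nat := fun u v =>
  parent_rel (hub_cycle_par D) u v || (u == 0) && (v == 8).

(* The 9-cycle 0, ..., 8 with a block of D + 6 further vertices at each of the
   hubs 0, 2, 5, which are at distances 2, 3 and 4 from each other. *)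
Definition hub_cycle D := label_graph (3 * D + 27) (hub_cycle_rel D).

(* The arc of length d starting at s has blocks based at A and B at its ends;
   the third hub c has the block based at C. *)
Definition hub_arc D d s A B c C :=
  [\/ [/\ d = 2, s = 0, A = 9, B = D + 15 & c = 5 /\ C = 2 * D + 21],
      [/\ d = 3, s = 2, A = D + 15, B = 2 * D + 21 & c = 0 /\ C = 9]
    | [/\ d = 4, s = 5, A = 2 * D + 21, B = 9 & c = 2 /\ C = D + 15]].

(** * Embedding a broom along an arc, and the map back *)

Definition arc_end d s := if s + d < 9 then s + d else s + d - 9.

(** Leaves of the second hub go to offsets 5 to [D + 5], past the legs of its block; hence the block
    size [D + 6]. *)
Definition arc_embed D d s A B v :=
  if v == 0 then s
  else if 4 < v < 5 + d then arc_end (v - 4) s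
  else if v <= D then A + v else B + (v - D + 4).

(* Folds the complementary arc, which is longer, onto the arc. *)
Definition arc_pos d s w :=
  let p := if w < s then w + 9 - s else w - s in minn (minn p d) (9 - p).

(** Label of the vertex at position [q] on the path between the hubs of a broom. *)
Definition spine_label q := if q == 0 then 0 else q + 4.

(** Block vertices outside the image of the embedding collapse onto the image of their hub; so does
    the whole third block. *)
Definition arc_retract D d s A B c w :=
  if w < 9 then spine_label (arc_pos d s w)
  else if A <= w < A + D + 6 then
    (if (0 < w - A < 5) || (5 + d <= w - A <= D) then w - A else 0)
  else if B <= w < B + D + 6 then
    (if w - B < 5 then 4 + d else w - B + D - 4)
  else spine_label (arc_pos d s c).

(** Lets later arithmetic treat the three arcs alike: the blocks avoid the cycle and each other. *)
Lemma hub_arc_bounds D d s A B c C : hub_arc D d s A B c C ->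
  [/\ 2 <= d <= 4, 9 <= A, 9 <= B, 9 <= C &
      [/\ A + D + 6 <= B \/ B + D + 6 <= A, A + D + 6 <= C \/ C + D + 6 <= A &
          B + D + 6 <= C \/ C + D + 6 <= B]].
Proof. by case=> -[-> _ -> -> [_ ->]]; do !split=> //; lia. Qed.

Lemma hub_cycle_par_block D d s A B c C i : hub_arc D d s A B c C -> i < D + 6 ->
  [/\ hub_cycle_par D (A + i) = block_par s A (A + i),
      hub_cycle_par D (B + i) = block_par (arc_end d s) B (B + i) &
      hub_cycle_par D (C + i) = block_par c C (C + i)].
Proof.
move=> arc iD.
have b0 : hub_cycle_par D (9 + i) = block_par 0 9 (9 + i).
  by rewrite /hub_cycle_par; split_ifs.
have b1 : hub_cycle_par D (D + 15 + i) = block_par 2 (D + 15) (D + 15 + i).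
  by rewrite /hub_cycle_par; split_ifs.
have b2 : hub_cycle_par D (2 * D + 21 + i) =
    block_par 5 (2 * D + 21) (2 * D + 21 + i).
  by rewrite /hub_cycle_par; split_ifs.
by case: arc => -[-> -> -> -> [-> ->]].
Qed.

Lemma arc_retract_spine D d s A B c w :
  w < 9 -> arc_retract D d s A B c w = spine_label (arc_pos d s w).
Proof. by rewrite /arc_retract => ->. Qed.

Lemma arc_retractA D d s A B c C i : hub_arc D d s A B c C -> i < D + 6 ->
  arc_retract D d s A B c (A + i) =
  if (0 < i < 5) || (5 + d <= i <= D) then i else 0.
Proof.
case/hub_arc_bounds=> d24 A9 B9 C9 _ iD.
by rewrite /arc_retract addKn; split_ifs.
Qed.

Lemma arc_retractB D d s A B c C i : hub_arc D d s A B c C -> i < D + 6 ->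
  arc_retract D d s A B c (B + i) = if i < 5 then 4 + d else i + D - 4.
Proof.
case/hub_arc_bounds=> d24 A9 B9 C9 [AB _ _] iD.
by rewrite /arc_retract addKn; split_ifs.
Qed.

Lemma arc_retractC D d s A B c C i : hub_arc D d s A B c C -> i < D + 6 ->
  arc_retract D d s A B c (C + i) = spine_label (arc_pos d s c).
Proof.
case/hub_arc_bounds=> d24 A9 B9 C9 [_ AC BC] iD.
by rewrite /arc_retract; split_ifs.
Qed.

Lemma arc_retract_hubs D d s A B c C : hub_arc D d s A B c C ->
  [/\ arc_retract D d s A B c s = 0,
      arc_retract D d s A B c (arc_end d s) = 4 + d &
      arc_retract D d s A B c c = spine_label (arc_pos d s c)].
Proof. by case=> -[-> -> _ _ [-> _]]. Qed.

Lemma arc_embedK D d s A B c C v : 9 <= D -> hub_arc D d s A B c C ->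
  v < 2 * D + 2 -> arc_retract D d s A B c (arc_embed D d s A B v) = v.
Proof.
move=> D9 arc vn; have [d24 _ _ _ _] := hub_arc_bounds arc; rewrite /arc_embed.
have [->|v0] := eqVneq v 0; first by case: (arc_retract_hubs arc).
case: ifP => arcv.
  (* As [d] is at most 4, the path labels lie among 5 to 8 and can be checked by computation. *)
  have: v \in iota 5 4 by rewrite !inE; lia.
  rewrite !inE => vv; case: arc arcv => -[-> -> _ _ [-> _]] arcv;
  by case/or4P: vv arcv => /eqP->.
case: leqP => vD; first by rewrite (arc_retractA arc) ?ifT //; lia.
by rewrite (arc_retractB arc) ?ifF; lia.
Qed.

Lemma arc_embed_lt D d s A B c C v : 9 <= D -> hub_arc D d s A B c C ->
  v < 2 * D + 2 -> arc_embed D d s A B v < 3 * D + 27.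
Proof.
move=> D9 arc vn; rewrite /arc_embed /arc_end.
by case: arc => -[? ? ? ? [? ?]]; subst; split_ifs; lia.
Qed.

Lemma arc_retract_lt D d s A B c C w : 9 <= D -> hub_arc D d s A B c C ->
  arc_retract D d s A B c w < 2 * D + 2.
Proof.
move=> D9 arc; have [d24 _ _ _ _] := hub_arc_bounds arc.
have spine x : spine_label (arc_pos d s x) < 2 * D + 2.
  by rewrite /spine_label /arc_pos; case: ifP => _; lia.
rewrite /arc_retract; case: ifP => // _; case: ifP => _; first by case: ifP; lia.
by case: ifP => // wB; case: ifP; lia.
Qed.

Lemma arc_embed_hom D d s A B c C v : 9 <= D -> hub_arc D d s A B c C ->
  0 < v < 2 * D + 2 ->
  let u' := arc_embed D d s A B (broom_par D d v) in
  let v' := arc_embed D d s A B v in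
  hub_cycle_rel D u' v' || hub_cycle_rel D v' u'.
Proof.
move=> D9 arc /andP[v0 vn] /=; have [d24 A9 B9 _ _] := hub_arc_bounds arc.
have [arcv|arcv] := boolP (4 < v < 5 + d).
  have: v \in iota 5 4 by rewrite !inE; lia.
  rewrite !inE => vv.
  have -> : broom_par D d v = if v == 5 then 0 else v.-1.
    by have := broom_parP D d v; case: ifP; lia.
  case: arc arcv => -[-> -> _ _ _] arcv;
  by case/or4P: vv arcv => /eqP->.
have block h X i : 9 <= X -> 0 < i -> i != 2 -> i != 4 ->
    hub_cycle_par D (X + i) = block_par h X (X + i) -> hub_cycle_rel D h (X + i).
  move=> X9 i0 i2 i4 E; rewrite /hub_cycle_rel /parent_rel E /block_par.
  by rewrite !eqn_add2l (negPf i2) (negPf i4) eqxx andbT addn_gt0 i0 orbT.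
have embE : arc_embed D d s A B v = if v <= D then A + v else B + (v - D + 4).
  by rewrite /arc_embed (negPf arcv) ifF //; lia.
case/or3P: (broom_parP D d v) => [/andP[vin]|/and3P[vin Dv]|/and3P[vin vD]] /eqP E.
- have vD : v <= D by lia.
  have -> : arc_embed D d s A B (broom_par D d v) = A + v.-1.
    by rewrite E /arc_embed; split_ifs.
  rewrite embE vD.
  have [ ] := hub_cycle_par_block arc (_ : v < D + 6); first by lia.
  rewrite /block_par ifT => [EA _ _|]; last by lia.
  by rewrite /hub_cycle_rel /parent_rel EA; lia.
- have -> : arc_embed D d s A B (broom_par D d v) = arc_end d s.
    by rewrite E /arc_embed addKn; split_ifs.
  rewrite embE leqNgt Dv /= block //; try lia.
  by case: (hub_cycle_par_block arc (_ : v - D + 4 < D + 6)); lia.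
- rewrite embE vD E {1}/arc_embed eqxx block //; try lia.
  by case: (hub_cycle_par_block arc (_ : v < D + 6)); lia.
Qed.

(** * The retraction sends edges to edges or contracts them *)

Definition weak_edge (e : rel nat) : rel nat :=
  fun x y => [|| x == y, e x y | e y x].

Lemma spine_weak_edge D d p q : 9 <= D -> 2 <= d <= 4 -> p <= d -> q <= d ->
  [|| p == q, p == q.+1 | q == p.+1] ->
  weak_edge (parent_rel (broom_par D d)) (spine_label p) (spine_label q).
Proof.
move=> D9 d24.
have step k : k < d ->
    parent_rel (broom_par D d) (spine_label k) (spine_label k.+1).
  move=> kd; rewrite /parent_rel /spine_label /=.
  by have := broom_parP D d (k.+1 + 4); case: ifP; lia.
rewrite /weak_edge => pd qd /or3P[/eqP->|/eqP pE|/eqP qE]; first by rewrite eqxx.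
  by rewrite pE step ?orbT // -pE.
by rewrite qE step ?orbT // -qE.
Qed.

Lemma arc_retract_spine_edge D d s A B c C u v :
  9 <= D -> hub_arc D d s A B c C -> u < 9 -> v < 9 ->
  v = u.+1 \/ u = 0 /\ v = 8 ->
  weak_edge (parent_rel (broom_par D d))
    (arc_retract D d s A B c u) (arc_retract D d s A B c v).
Proof.
move=> D9 arc u9 v9 uv; rewrite !arc_retract_spine //.
have [d24 _ _ _ _] := hub_arc_bounds arc.
have le x : arc_pos d s x <= d by rewrite /arc_pos; lia.
apply: spine_weak_edge => //.
(* First the closing edge, then the finitely many others, each computed for the three arcs. *)
case: uv v9 => [->|[-> ->]] v9; last by case: arc => -[-> -> _ _ _].
case: arc => -[-> -> _ _ _];
by do 9?[case: u u9 v9 => [|u] u9 v9 //].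
Qed.

Lemma arc_retract_blockA D d s A B c C i :
  9 <= D -> hub_arc D d s A B c C -> i < D + 6 ->
  weak_edge (parent_rel (broom_par D d))
    (arc_retract D d s A B c (block_par s A (A + i)))
    (arc_retract D d s A B c (A + i)).
Proof.
move=> D9 arc iD; have [d24 _ _ _ _] := hub_arc_bounds arc.
have par := broom_parP D d i; rewrite /block_par !eqn_add2l.
case: ifP => i24; last first.
  case: (arc_retract_hubs arc) => -> _ _; rewrite (arc_retractA arc iD).
  case: ifP => iP; last by rewrite /weak_edge eqxx.
  by rewrite /weak_edge /parent_rel; move: par; lia.
have -> : (A + i).-1 = A + i.-1 by lia.
rewrite !(arc_retractA arc) ?ifT; try lia.
by rewrite /weak_edge /parent_rel; move: par; lia.
Qed.

Lemma arc_retract_blockB D d s A B c C i :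
  9 <= D -> hub_arc D d s A B c C -> i < D + 6 ->
  weak_edge (parent_rel (broom_par D d))
    (arc_retract D d s A B c (block_par (arc_end d s) B (B + i)))
    (arc_retract D d s A B c (B + i)).
Proof.
move=> D9 arc iD; have [d24 _ _ _ _] := hub_arc_bounds arc.
rewrite /block_par !eqn_add2l; case: ifP => i24; last first.
  case: (arc_retract_hubs arc) => _ -> _; rewrite (arc_retractB arc iD).
  case: ifP => iP; first by rewrite /weak_edge eqxx.
  have := broom_parP D d (i + D - 4).
  by rewrite /weak_edge /parent_rel; lia.
have -> : (B + i).-1 = B + i.-1 by lia.
by rewrite !(arc_retractB arc) ?ifT /weak_edge ?eqxx //; lia.
Qed.

Lemma arc_retract_blockC D d s A B c C i :
  hub_arc D d s A B c C -> i < D + 6 ->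
  arc_retract D d s A B c (block_par c C (C + i)) =
  arc_retract D d s A B c (C + i).
Proof.
move=> arc iD; rewrite /block_par !eqn_add2l; case: ifP => i24; last first.
  by case: (arc_retract_hubs arc) => _ _ ->; rewrite (arc_retractC arc iD).
have -> : (C + i).-1 = C + i.-1 by lia.
by rewrite !(arc_retractC arc) //; lia.
Qed.

Lemma arc_retract_weak_hom D d s A B c C u v : 9 <= D -> hub_arc D d s A B c C ->
  v < 3 * D + 27 -> hub_cycle_rel D u v ->
  weak_edge (parent_rel (broom_par D d))
    (arc_retract D d s A B c u) (arc_retract D d s A B c v).
Proof.
move=> D9 arc vn uv; have [v9|v9] := ltnP v 9.
  have uv' : v = u.+1 \/ u = 0 /\ v = 8.
    by move: uv; rewrite /hub_cycle_rel /parent_rel /hub_cycle_par v9; lia.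
  have u9 : u < 9 by lia.
  exact: arc_retract_spine_edge D9 arc u9 v9 uv'.
have -> : u = hub_cycle_par D v.
  by move: uv; rewrite /hub_cycle_rel /parent_rel; lia.
have [X XABC [i iD ->]] : exists2 X, [\/ X = A, X = B | X = C] &
    exists2 i, i < D + 6 & v = X + i.
  have [X XE Xv] : exists2 X, [\/ X = 9, X = D + 15 | X = 2 * D + 21] &
      X <= v < X + D + 6.
    have [v1|v1] := ltnP v (D + 15); first by exists 9; [constructor 1 | lia].
    have [v2|v2] := ltnP v (2 * D + 21).
      by exists (D + 15); [constructor 2 | lia].
    by exists (2 * D + 21); [constructor 3 | lia].
  exists X; last by exists (v - X); lia.
  (* Which of [A], [B], [C] a block is depends on the arc. *)
  by case: arc XE => -[_ _ -> -> [_ ->]] [] ->;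
    [constructor 1|constructor 2|constructor 3|constructor 3|constructor 1|
     constructor 2|constructor 2|constructor 3|constructor 1].
have [parA parB parC] := hub_cycle_par_block arc iD.
case: XABC => ->; rewrite ?parA ?parB ?parC.
- exact: arc_retract_blockA D9 arc iD.
- exact: arc_retract_blockB D9 arc iD.
- by rewrite /weak_edge (arc_retract_blockC arc iD) eqxx.
Qed.

(** * The brooms inside the cycle, and the comparison of sizes *)

Lemma broom_hub_cycle_isometric D d s A B c C :
  9 <= D -> hub_arc D d s A B c C ->
  isometric_embeds (broom D d) (hub_cycle D).
Proof.
move=> D9 arc; have d24 : 2 <= d <= 4 by case: arc => -[->].
pose f (v : vtx (broom D d)) : vtx (hub_cycle D) :=
  Ordinal (arc_embed_lt D9 arc (ltn_ord v)).
pose r (w : vtx (hub_cycle D)) : vtx (broom D d) :=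
  Ordinal (arc_retract_lt w D9 arc).
have fK : cancel f r.
  by move=> v; apply: val_inj; apply: (arc_embedK D9 arc (ltn_ord v)).
apply: (@retract_isometric _ _ f r) => //; first by case: (broom_tree D9 d24).
  have half u v : parent_rel (broom_par D d) (u : 'I_ _) (v : 'I_ _) ->
      hub_cycle_rel D (f u : 'I_ _) (f v : 'I_ _)
      || hub_cycle_rel D (f v : 'I_ _) (f u : 'I_ _).
    case/andP=> v0 /eqP uv; have := arc_embed_hom (v := v) D9 arc.
    by rewrite /f /= uv; apply; rewrite v0 ltn_ord.
  move=> u v /andP[uv /orP uvE]; apply/andP; split.
    by rewrite (inj_eq (can_inj fK)).
  by case: uvE => /half //; rewrite orbC.
have half u v : hub_cycle_rel D (u : 'I_ _) (v : 'I_ _) ->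
    r u = r v \/ adj (r u) (r v).
  move=> uv; have := arc_retract_weak_hom D9 arc (ltn_ord v) uv.
  have [->|ruv] := eqVneq (r u) (r v); first by left.
  case/or3P=> [/eqP e|e|e]; first by case/eqP: ruv; apply: val_inj.
    by right; apply/andP; split=> //; apply/orP; left.
  by right; apply/andP; split=> //; apply/orP; right.
move=> u v /andP[_ /orP[|/half[->|uv]]]; [exact: half | by left | right].
by rewrite adj_sym.
Qed.

Theorem theorem5 (t : nat) (ht : 9 <= t) :
  exists T1 T2 T3 : sgraph,
    (is_tree T1 /\ #|vtx T1| = 2 * t ^ 3 + 2 /\ pathwidth_is T1 2) /\
    (is_tree T2 /\ #|vtx T2| = 2 * t ^ 3 + 2 /\ pathwidth_is T2 2) /\
    (is_tree T3 /\ #|vtx T3| = 2 * t ^ 3 + 2 /\ pathwidth_is T3 2) /\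
    forall U : sgraph, is_tree U -> isom_universal3 T1 T2 T3 U ->
      ~ min_isom_universal3 T1 T2 T3 U.
Proof.
have : 9 ^ 3 <= t ^ 3 by rewrite leq_exp2r.
move: (t ^ 3) => D D729; have D9 : 9 <= D by lia.
have ok d : 2 <= d <= 4 -> is_tree (broom D d) /\
    #|vtx (broom D d)| = 2 * D + 2 /\ pathwidth_is (broom D d) 2.
  move=> d24; split; first exact: broom_tree.
  by split; [exact: card_ord | exact: broom_pathwidth].
exists (broom D 2), (broom D 3), (broom D 4); do 3![split; first exact: ok].
move=> U [_ acU] univU [_ minU].
have univC : isom_universal3 (broom D 2) (broom D 3) (broom D 4) (hub_cycle D).
  split; [|split].
  - by apply: (@broom_hub_cycle_isometric D 2 0 9 (D + 15) 5 (2 * D + 21)) => //;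
      constructor 1.
  - by apply: (@broom_hub_cycle_isometric D 3 2 (D + 15) (2 * D + 21) 0 9) => //;
      constructor 2.
  - by apply: (@broom_hub_cycle_isometric D 4 5 (2 * D + 21) 9 2 (D + 15)) => //;
      constructor 3.
(* Minimality gives at most [3 * D + 27] vertices, the four hubs at least [4 * (D - 8) - 6];
   together [D <= 65], against [D >= 729]. *)
have := universal_acyclic_card D9 acU univU.
have := minU _ univC; rewrite [#|vtx (hub_cycle D)|]card_ord.
by move: #|vtx U|; clear -D729; lia.
Qed.
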